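(* Let $D\in\mathcal E^n$ have embedding dimension $r$. Let $\bar k_1,\bar k_2,\bar k_3$ be nonnegative integers and define $$\alpha_1:=1\!:\!(\bar k_1+\bar k_2),\quad \alpha_2:=(\bar k_1+1)\!:\!(\bar k_1+\bar k_2+\bar k_3)\subseteq 1\!:\!n,$$ $$k_1:=|\alpha_1|=\bar k_1+\bar k_2,\quad k_2:=|\alpha_2|=\bar k_2+\bar k_3,\quad k:=\bar k_1+\bar k_2+\bar k_3,$$ where $k_1,k_2\ge1$. For $i=1,2$, let $\bar D_i:=D[\alpha_i]\in\mathcal E^{k_i}$ have embedding dimension $t_i$, let $B_i:=\mathcal K^\dagger(\bar D_i)=\bar U_iS_i\bar U_i^T$, where $\bar U_i\in\mathcal M^{k_i\times t_i}$, $\bar U_i^T\bar U_i=I_{t_i}$, $S_i\in\mathcal S^{t_i}_{++}$, and let $U_i:=\begin{bmatrix}\bar U_i&\frac1{\sqrt{k_i}}e\end{bmatrix}\in\mathcal M^{k_i\times(t_i+1)}$. Let $t$ and $\bar U\in\mathcal M^{k\times(t+1)}$ satisfy $$\mathcal R(\bar U)=\mathcal R\left(\begin{bmatrix}U_1&0\\0&I_{\bar k_3}\end{bmatrix}\right)\cap\mathcal R\left(\begin{bmatrix}I_{\bar k_1}&0\\0&U_2\end{bmatrix}\right),\qquad \bar U^T\bar U=I_{t+1}.$$ Let $\beta\subseteq\alpha_1\cap\alpha_2$, $\bar D:=D[\beta]$, $B:=\mathcal K^\dagger(\bar D)$, and $\bar U_\beta:=\bar U[\beta,:]$. Let $\begin{bmatrix}\bar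 V&\frac{\bar U^Te}{\|\bar U^Te\|}\end{bmatrix}\in\mathcal M^{t+1}$ be orthogonal, and let $$Z:=(J\bar U_\beta\bar V)^\dagger\,B\,\left((J\bar U_\beta\bar V)^\dagger\right)^T.$$ If the embedding dimension of $\bar D$ is $r$, then $t=r$, $Z\in\mathcal S^r_{++}$ is the unique solution of the equation $$(J\bar U_\beta\bar V)\,Z\,(J\bar U_\beta\bar V)^T=B,$$ and $$D[\alpha_1\cup\alpha_2]=\mathcal K\left((\bar U\bar V)\,Z\,(\bar U\bar V)^T\right).$$
   Context: Notation. $\mathcal S^n$ is the space of real symmetric $n\times n$ matrices; $\mathcal S^n_+$, $\mathcal S^n_{++}$ are the positive semidefinite and positive definite matrices in $\mathcal S^n$. $\mathcal M^{p\times q}$ is the space of real $p\times q$ matrices and $\mathcal M^p=\mathcal M^{p\times p}$. $\mathcal R(\cdot)$ denotes range (column space) and, for a matrix $A$, $A^\dagger$ is the Moore–Penrose generalized inverse. $e$ is the all-ones vector of appropriate dimension, and $a\!:\!b=\{a,a+1,\dots,b\}$. For an index set $\alpha$, $Y[\alpha]$ is the principal submatrix of $Y$ with rows and columns indexed by $\alpha$, and $\bar U[\beta,:]$ is the submatrix of $\bar U$ formed by the rows indexed by $\beta$ (the rows of $\bar U$ being indexed by $1\!:\!k=\alpha_1\cup\alpha_2$). $J=I-\frac1m ee^T$ is the orthogonal projection onto $\{e\}^\perp$ in $\mathbb R^m$, of the appropriate order $m$ (here $m=|\beta|$ in the formulas for $Z$). Euclidean distance matrices. $D\in\mathcal S^n$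 is a Euclidean distance matrix (EDM) if there are an integer $r\ge0$ and points $p_1,\dots,p_n\in\mathbb R^r$ with $D_{ij}=\|p_i-p_j\|_2^2$ for all $i,j$ (squared distances); the smallest such $r$ is the embedding dimension of $D$. $\mathcal E^n\subset\mathcal S^n$ is the cone of $n\times n$ EDMs. Operators. $\mathcal K:\mathcal S^n\to\mathcal S^n$ is $\mathcal K(Y)=\operatorname{diag}(Y)e^T+e\operatorname{diag}(Y)^T-2Y$, where $\operatorname{diag}(Y)$ is the vector of diagonal entries of $Y$. Its Moore–Penrose generalized inverse is $\mathcal K^\dagger(D)=-\frac12J\,\mathrm{offDiag}(D)\,J$, where $\mathrm{offDiag}(D)$ is $D$ with its diagonal replaced by zeros. The same symbols are used for matrices of any order (with $n$ replaced by the order). *)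

(* Defs.v *)
From HB Require Import structures.
From mathcomp Require Import all_boot all_order all_algebra.
From mathcomp Require Import reals.

Set Implicit Arguments.
Unset Strict Implicit.
Unset Printing Implicit Defensive.

Import Order.TTheory GRing.Theory Num.Theory.

Local Open Scope ring_scope.

Section MatrixNotions.
Variable R : realType.

Definition ones n : 'cV[R]_n := const_mx 1.

(* Euclidean norm; the norm MathComp-Analysis puts on matrices is the sup norm. *)
Definition enorm n (v : 'cV[R]_n) : R := Num.sqrt (\sum_i v i 0 ^+ 2).

Definition posdef n (S : 'M[R]_n) : Prop :=
  S^T = S /\ forall x : 'cV[R]_n, x != 0 -> 0 < (x^T *m S *m x) 0 0.

Definition is_mpinv m n (A : 'M[R]_(m, n)) (X : 'M[R]_(n, m)) : bool :=
  [&& A *m X *m A == A, X *m A *m X == X,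
      (A *m X)^T == A *m X & (X *m A)^T == X *m A].

Lemma gram_unitmx m n (F : 'M[R]_(m, n)) : row_free F -> F *m F^T \in unitmx.
Proof.
move=> Ffree; rewrite -row_free_unit -kermx_eq0; apply/eqP/row_matrixP=> i.
rewrite row0; set v := row i _.
have v0 : v *m (F *m F^T) = 0.
  by rewrite /v -row_mul mulmx_ker row0.
suff vF0 : v *m F = 0.
  by apply: (row_free_inj Ffree); rewrite vF0 mul0mx.
have : ((v *m F) *m (v *m F)^T) 0 0 = 0.
  by rewrite trmx_mul mulmxA -(mulmxA v) v0 mul0mx mxE.
rewrite mxE => /eqP; rewrite psumr_eq0; last first.
  by move=> j _; rewrite [X in _ * X]mxE -expr2 sqr_ge0.
move=> /allP h; apply/rowP=> j; have := h j (mem_index_enum _).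
by rewrite [X in _ * X]mxE -expr2 sqrf_eq0 => /eqP ->; rewrite mxE.
Qed.

Lemma ex_mpinv m n (A : 'M[R]_(m, n)) : exists X, is_mpinv A X.
Proof.
have EA := esym (mulmx_base A).
have uF := gram_unitmx (row_base_free A).
have uC : (col_base A)^T *m col_base A \in unitmx.
  rewrite -{2}[col_base A]trmxK; apply: gram_unitmx.
  by rewrite /row_free mxrank_tr; apply: col_base_full.
move: (\rank A) (col_base A) (row_base A) EA uF uC => r C F EA uF uC.
pose G := invmx (F *m F^T); pose H := invmx (C^T *m C).
have GT : G^T = G by rewrite /G trmx_inv trmx_mul trmxK.
have HT : H^T = H by rewrite /H trmx_inv trmx_mul trmxK.
pose X := F^T *m G *m H *m C^T.
have AX : A *m X = C *m H *m C^T.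
  rewrite {1}EA /X !mulmxA -(mulmxA C F) -(mulmxA C (F *m _)) mulmxV //.
  by rewrite mulmx1.
have XA : X *m A = F^T *m G *m F.
  rewrite {1}EA /X !mulmxA -(mulmxA _ C^T C) -(mulmxA _ H) mulVmx //.
  by rewrite mulmx1.
exists X; apply/and4P; split; apply/eqP.
- rewrite AX EA !mulmxA -(mulmxA _ C^T C) -(mulmxA _ H) mulVmx //.
  by rewrite mulmx1.
- rewrite XA /X !mulmxA -(mulmxA _ F F^T) -(mulmxA _ (F *m _)) mulmxV //.
  by rewrite mulmx1.
- by rewrite AX !trmx_mul trmxK HT mulmxA.
- by rewrite XA !trmx_mul trmxK GT mulmxA.
Qed.

(* The Moore-Penrose inverse, i.e. the matrix satisfying the four Penrose
   equations.  Mathcomp's pinvmx is only some generalized inverse. *)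
Definition mpinv m n (A : 'M[R]_(m, n)) : 'M[R]_(n, m) := xchoose (ex_mpinv A).

Lemma mpinvP m n (A : 'M[R]_(m, n)) : is_mpinv A (mpinv A).
Proof. exact: xchooseP. Qed.

Lemma mpinv_uniq m n (A : 'M[R]_(m, n)) X : is_mpinv A X -> X = mpinv A.
Proof.
move: (mpinvP A); move: (mpinv A) => Y.
move=> /and4P[/eqP y1 /eqP y2 /eqP y3 /eqP y4].
move=> /and4P[/eqP x1 /eqP x2 /eqP x3 /eqP x4].
have AE : A *m X = A *m Y.
  by rewrite -[LHS]x3 -[in LHS]y1 -(mulmxA _ A X) trmx_mul x3 y3 mulmxA x1.
have EA : X *m A = Y *m A.
  by rewrite -[LHS]x4 -[in LHS]y1 -(mulmxA A) mulmxA trmx_mul x4 y4 -mulmxA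
     (mulmxA A) x1.
by rewrite -x2 -mulmxA AE mulmxA EA.
Qed.

(* The orthogonal projection J onto the orthogonal complement of ones. *)
Definition Jmx n : 'M[R]_n := 1%:M - n%:R^-1 *: (ones n *m (ones n)^T).

Definition diagv n (Y : 'M[R]_n) : 'cV[R]_n := \col_i Y i i.

Definition offDiag n (D : 'M[R]_n) : 'M[R]_n :=
  \matrix_(i, j) (if i == j then 0 else D i j).

Definition Kop n (Y : 'M[R]_n) : 'M[R]_n :=
  diagv Y *m (ones n)^T + ones n *m (diagv Y)^T - 2%:R *: Y.

Definition Kdag n (D : 'M[R]_n) : 'M[R]_n :=
  - (2%:R^-1 *: (Jmx n *m offDiag D *m Jmx n)).

Definition EDM_in n (r : nat) (D : 'M[R]_n) : Prop :=
  exists p : 'I_n -> 'cV[R]_r, forall i j, D i j = enorm (p i - p j) ^+ 2.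

Definition EDM n (D : 'M[R]_n) : Prop := exists r, EDM_in r D.

Definition embdim n (D : 'M[R]_n) (r : nat) : Prop :=
  EDM_in r D /\ forall s, EDM_in s D -> (r <= s)%N.

Definition psub n (D : 'M[R]_n) (A : {set 'I_n}) : 'M[R]_#|A| :=
  mxsub (@enum_val _ (mem A)) (@enum_val _ (mem A)) D.

(* For a matrix U whose rows are indexed by A, the rows indexed by B. *)
Definition rows_of n p (A B : {set 'I_n}) (sBA : B \subset A)
    (U : 'M[R]_(#|A|, p)) : 'M[R]_(#|B|, p) :=
  rowsub (fun i : 'I_#|B| =>
    enum_rank_in (subsetP sBA _ (enum_valP i)) (enum_val i)) U.

End MatrixNotions.

Arguments ones {R} n.
Arguments Jmx {R} n.

(* Indices are 0-based: alpha1 and alpha2 are the intervals [0, c1 + c2) and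
   [c1, c1 + c2 + c3) of 'I_n. *)
Definition alpha1 n (c1 c2 : nat) : {set 'I_n} := [set i : 'I_n | (i < c1 + c2)%N].

Definition alpha2 n (c1 c2 c3 : nat) : {set 'I_n} :=
  [set i : 'I_n | (c1 <= i < c1 + c2 + c3)%N].

Lemma card_interval n a b : (b <= n)%N ->
  #|[set i : 'I_n | (a <= i < b)%N]| = (b - a)%N.
Proof.
move=> bn; rewrite -sum1dep_card.
rewrite -(big_mkord (fun i => a <= i < b)%N (fun=> 1%N)).
rewrite -(big_nat_widen 0 b n (fun i => a <= i)%N) // -(big_nat_widenl a 0 b xpredT) //.
by rewrite sum_nat_const_nat muln1.
Qed.

Section Blocks.
Variables (n c1 c2 c3 : nat) (hn : (c1 + c2 + c3 <= n)%N).
Let a1 := alpha1 n c1 c2.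
Let a2 := alpha2 n c1 c2 c3.

Lemma card_alpha1 : #|a1| = (c1 + c2)%N.
Proof.
rewrite -[RHS]subn0 -(@card_interval n) //.
by apply: leq_trans hn; apply: leq_addr.
Qed.

Lemma card_alpha2 : #|a2| = (c2 + c3)%N.
Proof. by rewrite card_interval // -addnA addKn. Qed.

Lemma card_alphaU : #|a1 :|: a2| = (c1 + c2 + c3)%N.
Proof.
rewrite -[RHS]subn0 -(@card_interval n) //; apply: eq_card => i.
rewrite !inE; case: (ltnP i (c1 + c2)%N) => /= h.
  by rewrite (leq_trans h) ?leq_addr.
by rewrite (leq_trans (leq_addr _ _) h).
Qed.

Lemma card_blocks1 : (#|a1| + c3)%N = #|a1 :|: a2|.
Proof. by rewrite card_alpha1 card_alphaU. Qed.

Lemma card_blocks2 : (c1 + #|a2|)%N = #|a1 :|: a2|.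
Proof. by rewrite card_alpha2 card_alphaU addnA. Qed.

Variables (R : realType) (p : nat).

(* The block-diagonal matrices diag(U1, I) and diag(I, U2), cast so that their
   rows are indexed by the union of alpha1 and alpha2. *)
Definition blocks1 (U1 : 'M[R]_(#|a1|, p)) : 'M[R]_(#|a1 :|: a2|, p + c3) :=
  castmx (card_blocks1, erefl) (block_mx U1 0 0 1%:M).

Definition blocks2 (U2 : 'M[R]_(#|a2|, p)) : 'M[R]_(#|a1 :|: a2|, c1 + p) :=
  castmx (card_blocks2, erefl) (block_mx 1%:M 0 0 U2).

End Blocks.

Lemma sub_setIU n (A B C : {set 'I_n}) : C \subset A :&: B -> C \subset A :|: B.
Proof. by move=> h; apply: subset_trans h (subset_trans (subsetIl _ _) (subsetUl _ _)). Qed.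

(* Main.v *)
Require Import Defs.
From mathcomp Require Import all_boot all_order all_algebra.
From mathcomp Require Import reals.
From mathcomp Require Import ring lra zify.
Import Order.TTheory GRing.Theory Num.Theory.
Local Open Scope ring_scope.
Set Implicit Arguments.
Unset Strict Implicit.
Unset Printing Implicit Defensive.

(** Realize [D] by points in R^r, the rows of [P], and let [homog P = [P e]]
be their homogeneous coordinates.  Two facts reduce the theorem to linear
algebra on these matrices.

First, a set of points has embedding dimension [r] in R^r only if no
hyperplane contains it, that is, only if [homog] of it has independent columns
([homog_free]): otherwise an isometry of the hyperplane onto R^(r-1) would
give a smaller realization ([sqdist_drop_coord]).  This applies to the points
of [beta], hence to all the points of [alpha1 :|: alpha2].

Second, [Kdag (sqdist P) = (J P) (J P)^T], so an orthonormal basis of the range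
of this matrix together with [e] spans the column space of [homog P]
([homog_colspace]).  A vector in the intersection of the two extended column
spaces is therefore an affine function of the points on [alpha1] and an affine
function of the points on [alpha2].  The two affine functions agree on [beta],
where an affine function is determined by its values, so they are equal and
the intersection is the column space of [homog P] for the union
([homog_glue]).  Comparing ranks gives [t = r].

Removing the direction of [e] from this space gives the orthonormal basis
[Ubar Vbar] of the space of centered coordinates, so that
[J P = (Ubar Vbar) Y] for some [Y] ([centered_coords]).  Restricting to [beta]
and centering again, [J P_beta = M Y].  Independence makes [Y] invertible and
[M] of full column rank, so [B = M (Y Y^T) M^T] forces [Z = Y Y^T].  Then
[(Ubar Vbar) Z (Ubar Vbar)^T = (J P) (J P)^T] is the Gram matrix of the
centered points and gives all the distances ([completion]). *)

(** * Point configurations and their squared distances *)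

Section Points.
Variable R : realType.

Definition sqdist m r (P : 'M[R]_(m, r)) : 'M[R]_m :=
  \matrix_(i, j) \sum_l (P i l - P j l) ^+ 2.

Definition homog m r (P : 'M[R]_(m, r)) : 'M[R]_(m, r + 1) :=
  row_mx P (ones m).

Lemma EDM_inP m r (D : 'M[R]_m) :
  EDM_in r D <-> exists P : 'M[R]_(m, r), D = sqdist P.
Proof.
have enormE q (v : 'cV[R]_q) : enorm v ^+ 2 = \sum_i v i 0 ^+ 2.
  by rewrite sqr_sqrtr // sumr_ge0 // => i _; apply: sqr_ge0.
split=> [[p Dp]|[P ->]].
  exists (\matrix_(i, l) p i l 0); apply/matrixP=> i j.
  by rewrite Dp enormE mxE; apply: eq_bigr => l _; rewrite !mxE.
exists (fun i => (row i P)^T) => i j.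
by rewrite enormE mxE; apply: eq_bigr => l _; rewrite !mxE.
Qed.

Lemma sqdist_rowsub m m' r (f : 'I_m' -> 'I_m) (P : 'M[R]_(m, r)) :
  sqdist (rowsub f P) = mxsub f f (sqdist P).
Proof. by apply/matrixP=> i j; rewrite !mxE; apply: eq_bigr => l _; rewrite !mxE. Qed.

Lemma sqdist_translate m r (P : 'M[R]_(m, r)) (c : 'rV[R]_r) :
  sqdist (P - ones m *m c) = sqdist P.
Proof.
apply/matrixP=> i j; rewrite !mxE; apply: eq_bigr => l _.
by rewrite !mxE !big_ord1 !mxE; congr (_ ^+ 2); ring.
Qed.

(** The expansion |x - y|^2 = |x|^2 + |y|^2 - 2 <x, y>. *)
Lemma sqdistE m r (P : 'M[R]_(m, r)) : sqdist P = Kop (P *m P^T).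
Proof.
apply/matrixP=> i j; rewrite !mxE !big_ord1 !mxE mulr1 mul1r mulr_sumr.
rewrite -big_split -sumrB /=; apply: eq_bigr => l _; rewrite !mxE; ring.
Qed.

(** * Centering *)

Lemma trmx_Jmx m : (Jmx m : 'M[R]_m)^T = Jmx m.
Proof. by rewrite /Jmx linearB /= trmx1 linearZ /= trmx_mul trmxK. Qed.

Lemma ones_dot m : (ones m)^T *m ones m = (m%:R : R)%:M.
Proof.
apply/matrixP=> i j; rewrite !ord1 !mxE (eq_bigr (fun=> 1)) => [|l _].
  by rewrite sumr_const card_ord.
by rewrite !mxE mulr1.
Qed.

(** For [m = 0] the division by [m] is harmless, as all the matrices are empty. *)
Lemma Jmx_ones m : (Jmx m : 'M[R]_m) *m ones m = 0.
Proof.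
case: m => [|m]; first by apply/matrixP; case.
rewrite mulmxBl mul1mx -scalemxAl -mulmxA ones_dot mul_mx_scalar scalerA.
by rewrite mulVf ?pnatr_eq0 // scale1r subrr.
Qed.

Lemma ones_Jmx m : (ones m)^T *m (Jmx m : 'M[R]_m) = 0.
Proof. by rewrite -[LHS]trmxK trmx_mul trmx_Jmx trmxK Jmx_ones trmx0. Qed.

Definition mean m r (P : 'M[R]_(m, r)) : 'rV[R]_r :=
  m%:R^-1 *: ((ones m)^T *m P).

Lemma JmxE m r (P : 'M[R]_(m, r)) : Jmx m *m P = P - ones m *m mean P.
Proof. by rewrite mulmxBl mul1mx -scalemxAl -mulmxA scalemxAr. Qed.

(** Squared distances have zero diagonal, so [offDiag] fixes them, and the two
rank-one terms of [Kop] are killed by [J e = 0]. *)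
Lemma Kdag_sqdist m r (P : 'M[R]_(m, r)) :
  Kdag (sqdist P) = (Jmx m *m P) *m (Jmx m *m P)^T.
Proof.
have -> : Kdag (sqdist P) = - (2%:R^-1 *: (Jmx m *m sqdist P *m Jmx m)).
  rewrite /Kdag; congr (- (_ *: (_ *m _ *m _))).
  apply/matrixP=> i j; rewrite mxE; case: eqP => [<-|//].
  by rewrite mxE big1 // => l _; rewrite subrr expr0n.
rewrite sqdistE /Kop; set d := diagv _.
rewrite (mulmxBr (Jmx m)) (mulmxDr (Jmx m)) 2!mulmxA Jmx_ones mul0mx addr0 mulmxBl.
rewrite -(mulmxA _ (ones m)^T) ones_Jmx mulmx0 sub0r scalerN opprK.
rewrite -scalemxAr -scalemxAl scalerA mulVf ?pnatr_eq0 // scale1r.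
by rewrite trmx_mul trmx_Jmx !mulmxA.
Qed.

(** * Affine independence and embedding dimension *)

(** The diagonal entries of [A A^T] are sums of squares of the rows of [A]. *)
Lemma mulmx_tr_eq0 m n (A : 'M[R]_(m, n)) : A *m A^T = 0 -> A = 0.
Proof.
move=> A0; apply/matrixP=> i j; have /matrixP/(_ i i)/eqP := A0.
rewrite !mxE psumr_eq0 => [|l _]; last by rewrite mxE -expr2 sqr_ge0.
by move=> /allP/(_ j (mem_index_enum _)); rewrite mxE -expr2 sqrf_eq0 => /eqP.
Qed.

(** The range of a matrix is the row space of its transpose. *)
Lemma col_subP m n p (A : 'M[R]_(m, n)) (B : 'M[R]_(m, p)) :
  reflect (exists X, A = B *m X) (A^T <= B^T)%MS.
Proof.
apply: (iffP submxP) => [[X AX]|[X ->]]; exists X^T; last exact: trmx_mul.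
by rewrite -[LHS]trmxK AX trmx_mul trmxK.
Qed.

Lemma col_freeP m n (A : 'M[R]_(m, n)) :
  (forall v : 'cV_n, A *m v = 0 -> v = 0) <-> row_free A^T.
Proof.
split=> [A0|/row_free_inj Af v Av].
  rewrite -kermx_eq0; apply/eqP/row_matrixP=> i; rewrite row0.
  apply: trmx_inj; rewrite trmx0; apply: A0; apply: trmx_inj.
  by rewrite trmx_mul trmxK trmx0 -row_mul mulmx_ker row0.
by apply: trmx_inj; apply: Af; rewrite /= -trmx_mul Av !trmx0 mul0mx.
Qed.

(** If all the points lie in the hyperplane <v, x> = a, the map
x |-> x - x_0 / (s + v_0) *: v, followed by forgetting coordinate 0, is an
isometry on the differences of points.  For s^2 = |v|^2 it agrees, away from
coordinate 0, with the reflection exchanging the lines spanned by [v] and by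
the first basis vector, which maps the vectors orthogonal to [v] to vectors
whose coordinate 0 vanishes. *)
Lemma sqdist_drop_coord m r (P : 'M[R]_(m, r.+1)) (v : 'cV[R]_r.+1) a :
  v != 0 -> P *m v = a *: ones m -> EDM_in r (sqdist P).
Proof.
move=> v0 Pv; apply/EDM_inP.
(* One of the two square roots of |v|^2 works, as otherwise v = 0. *)
have [s s2 sv0] : exists2 s, s ^+ 2 = \sum_i v i 0 ^+ 2 & s + v 0 0 != 0.
  have sum0 : 0 <= \sum_i v i 0 ^+ 2 by apply: sumr_ge0 => i _; apply: sqr_ge0.
  have [N0|] := eqVneq (Num.sqrt (\sum_i v i 0 ^+ 2) + v 0 0) 0; last first.
    by move=> ?; exists (Num.sqrt (\sum_i v i 0 ^+ 2)); rewrite ?sqr_sqrtr.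
  exists (- Num.sqrt (\sum_i v i 0 ^+ 2)); first by rewrite sqrrN sqr_sqrtr.
  apply: contra_neq v0 => N1.
  have sq0 : Num.sqrt (\sum_i v i 0 ^+ 2) = 0 by lra.
  apply: trmx_inj; rewrite trmx0; apply: mulmx_tr_eq0; rewrite trmxK.
  apply/matrixP=> i j; rewrite !ord1 [RHS]mxE.
  have := sqr_sqrtr sum0; rewrite sq0 expr2 mul0r => /esym; apply: etrans; rewrite mxE.
  by apply: eq_bigr => l _; rewrite mxE expr2.
(* x below is a difference of two points, hence orthogonal to v; the two sums
   over the remaining coordinates are then known from v_0, x_0 and s. *)
exists (\matrix_(i, l) (P i (lift 0 l) - v (lift 0 l) 0 * P i 0 / (s + v 0 0))).
apply/matrixP=> i j; rewrite !mxE big_ord_recl /=.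
set x := fun l => P i l - P j l.
have vx : \sum_l v l 0 * x l = 0.
  have /matrixP Pv' := Pv; have := Pv' i 0; have := Pv' j 0; rewrite !mxE => Pj Pi.
  rewrite -[RHS](subrr (a * 1)) -{1}Pi -Pj -sumrB.
  by apply: eq_bigr => l _; rewrite /x; ring.
rewrite big_ord_recl /= in vx; rewrite big_ord_recl /= in s2.
pose q := x 0 / (s + v 0 0).
rewrite [RHS](eq_bigr (fun l => x (lift 0 l) ^+ 2
   - 2 * q * (v (lift 0 l) 0 * x (lift 0 l)) + q ^+ 2 * v (lift 0 l) 0 ^+ 2)); last first.
  by move=> l _; rewrite !mxE /q /x; ring.
rewrite big_split sumrB /= -!mulr_sumr.
set sx := \sum_(l < r) x _ ^+ 2; rewrite -/(x 0).
have -> : \sum_(l < r) v (lift 0 l) 0 * x (lift 0 l) = - (v 0 0 * x 0) by lra.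
have -> : \sum_(l < r) v (lift 0 l) 0 ^+ 2 = s ^+ 2 - v 0 0 ^+ 2 by lra.
by rewrite -/sx /q; field.
Qed.

(** A relation between the columns of [homog P] is the equation of a hyperplane
containing all the points, which would lower the embedding dimension.  A
nonempty configuration is required because a relation on the column of ones
alone has to be excluded. *)
Lemma homog_free m r (P : 'M[R]_(m, r)) :
  (0 < m)%N -> embdim (sqdist P) r -> row_free (homog P)^T.
Proof.
move=> m0 [_ rmin]; apply/col_freeP => v.
rewrite -[v]vsubmxK mul_row_col [dsubmx v]mx11_scalar mul_mx_scalar.
move: (usubmx v) (dsubmx v 0 0) => {v} u a uva.
have u0 : u = 0.
  case: r => [|r] in P u rmin uva *; first exact: flatmx0.
  apply/eqP/negPn/negP => u0; have: (r < r)%N; last by rewrite ltnn.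
  apply/rmin/(sqdist_drop_coord (a := - a) u0).
  by rewrite scaleNr -[RHS]add0r -uva addrK.
move: uva; rewrite u0 mulmx0 add0r => /matrixP/(_ (Ordinal m0) 0).
by rewrite !mxE mulr1 => ->; rewrite raddf0 col_mx0.
Qed.

(** * Column spaces of homogeneous coordinates *)

Lemma posdef_unitmx n (S : 'M[R]_n) : posdef S -> S \in unitmx.
Proof.
move=> [S_sym S_pos]; rewrite -unitmx_tr -row_free_unit.
apply/col_freeP => v Sv; apply/eqP/negPn/negP => /S_pos.
by rewrite -mulmxA Sv mulmx0 mxE ltxx.
Qed.

Lemma posdef_gram n p (Y : 'M[R]_(n, p)) : row_free Y -> posdef (Y *m Y^T).
Proof.
move=> Yfree; split=> [|x x0]; first by rewrite trmx_mul trmxK.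
have -> : x^T *m (Y *m Y^T) *m x = (x^T *m Y) *m (x^T *m Y)^T.
  by rewrite trmx_mul trmxK !mulmxA.
rewrite lt_def; apply/andP; split; last first.
  by rewrite mxE sumr_ge0 // => l _; rewrite [X in _ * X]mxE -expr2 sqr_ge0.
apply: contra_neq x0 => xY0; apply: trmx_inj; rewrite trmx0.
apply: (row_free_inj Yfree); rewrite /= mul0mx; apply: mulmx_tr_eq0.
by apply/matrixP=> i j; rewrite !ord1 xY0 mxE.
Qed.

(** [J P] and [(J P) (J P)^T = U S U^T] have the same column space, that of [U],
and [J P] differs from [P] by multiples of [e] only. *)
Lemma homog_colspace m r t (P : 'M[R]_(m, r)) (U : 'M[R]_(m, t)) S c :
    Kdag (sqdist P) = U *m S *m U^T -> U^T *m U = 1%:M -> posdef S -> c != 0 ->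
  ((row_mx U (c *: ones m))^T :=: (homog P)^T)%MS.
Proof.
rewrite Kdag_sqdist => USU UU /posdef_unitmx Sunit c0; apply/eqmxP/andP; split.
  set W := P^T *m (Jmx m)^T *m U *m invmx S.
  have UE : U = P *m W - ones m *m mean (P *m W).
    rewrite -JmxE /W !mulmxA -[RHS]mulmxA.
    have -> : Jmx m *m P *m P^T *m (Jmx m)^T = U *m S *m U^T.
      by rewrite -USU trmx_mul !mulmxA.
    by rewrite !mulmxA -(mulmxA _ U^T) UU mulmx1 mulmxK.
  apply/col_subP; exists (block_mx W 0 (- mean (P *m W)) c%:M).
  by rewrite mul_row_block mulmx0 add0r mul_mx_scalar mulmxN -UE.
(* E projects onto the orthogonal complement of the columns of U.  It kills
   (J P) (J P)^T, hence also J P. *)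
set E := 1%:M - U *m U^T.
have EU : E *m U = 0 by rewrite mulmxBl mul1mx -mulmxA UU mulmx1 subrr.
have EJP : E *m (Jmx m *m P) = 0.
  apply: mulmx_tr_eq0; move: (Jmx m *m P) USU => X USU.
  by rewrite trmx_mul mulmxA -(mulmxA E) USU !mulmxA EU !mul0mx.
apply/col_subP; exists (block_mx (U^T *m (Jmx m *m P)) 0 (c^-1 *: mean P) c^-1%:M).
rewrite mul_row_block mulmx0 add0r mul_mx_scalar [c^-1 *: (c *: _)]scalerA mulVf // scale1r.
rewrite -(scalemxAl c) -(scalemxAr c^-1) [c *: _]scalerA mulfV // scale1r.
congr row_mx; move/eqP: EJP; rewrite mulmxBl mul1mx subr_eq0 -mulmxA => /eqP <-.
by rewrite JmxE subrK.
Qed.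

Lemma homog_rowsub m m' r (f : 'I_m' -> 'I_m) (P : 'M[R]_(m, r)) :
  homog (rowsub f P) = rowsub f (homog P).
Proof.
by apply/matrixP=> i j; rewrite !mxE; case: (split j) => l; rewrite !mxE.
Qed.

(** A hyperplane containing all the points contains those selected by [f]. *)
Lemma homog_free_rowsub m m' r (f : 'I_m' -> 'I_m) (P : 'M[R]_(m, r)) :
  row_free (homog (rowsub f P))^T -> row_free (homog P)^T.
Proof.
move=> /col_freeP Pf; apply/col_freeP => v Pv; apply: Pf.
by rewrite homog_rowsub mul_rowsub_mx Pv; apply/matrixP=> i j; rewrite !mxE.
Qed.

(** The coefficient matrices [X1] and [X2] that express [W] on the two patches
agree, because both express [W] on their common part, where homogeneous
coordinates have independent columns. *)
Lemma homog_glue k k1 k2 b r q (P : 'M[R]_(k, r)) (W : 'M[R]_(k, q))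
    (f1 : 'I_k1 -> 'I_k) (f2 : 'I_k2 -> 'I_k)
    (g1 : 'I_b -> 'I_k1) (g2 : 'I_b -> 'I_k2) :
    f1 \o g1 =1 f2 \o g2 ->
    (forall i, (exists j, i = f1 j) \/ (exists j, i = f2 j)) ->
    row_free (homog (rowsub (f1 \o g1) P))^T ->
  (W^T <= (homog P)^T)%MS =
    ((rowsub f1 W)^T <= (homog (rowsub f1 P))^T)%MS &&
    ((rowsub f2 W)^T <= (homog (rowsub f2 P))^T)%MS.
Proof.
move=> fg cover Pf; rewrite !homog_rowsub.
apply/col_subP/andP => [[X ->]|[/col_subP[X1 W1] /col_subP[X2 W2]]].
  by split; apply/col_subP; exists X; rewrite mul_rowsub_mx.
have X12 : X1 = X2.
  apply: trmx_inj; apply: (row_free_inj Pf); rewrite /= -!trmx_mul; congr _^T.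
  rewrite homog_rowsub; apply/matrixP=> i j.
  rewrite mul_rowsub_mx mxE [in RHS](eq_rowsub _ fg) mul_rowsub_mx mxE.
  move/matrixP/(_ (g1 i) j): W1; rewrite mul_rowsub_mx !mxE => <-.
  move/matrixP/(_ (g2 i) j): W2; rewrite mul_rowsub_mx !mxE => <-.
  by have /= -> := fg i.
exists X1; apply/matrixP=> i l; have [[j ->]|[j ->]] := cover i.
  by move/matrixP/(_ j l): W1; rewrite mul_rowsub_mx !mxE.
by rewrite X12; move/matrixP/(_ j l): W2; rewrite mul_rowsub_mx !mxE.
Qed.

(** The identity block leaves the last rows of [W] unconstrained. *)
Lemma block_range1 k1 k3 k (e : (k1 + k3)%N = k) p q
    (U : 'M[R]_(k1, p)) (W : 'M[R]_(k, q)) :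
  (W^T <= (castmx (e, erefl) (block_mx U 0 0 1%:M))^T)%MS =
  ((rowsub (cast_ord e \o lshift k3) W)^T <= U^T)%MS.
Proof.
case: k / e in W *; rewrite castmx_id.
have -> : rowsub (cast_ord erefl \o lshift k3) W = usubmx W.
  by apply/matrixP=> i j; rewrite !mxE /= cast_ord_id.
apply/col_subP/col_subP => [[X ->]|[X WX]].
  by exists (usubmx X); rewrite -{1}[X]vsubmxK mul_block_col mul0mx addr0 col_mxKu.
exists (col_mx X (dsubmx W)).
by rewrite mul_block_col !mul0mx mul1mx addr0 add0r -WX vsubmxK.
Qed.

Lemma block_range2 k1 k2 k (e : (k1 + k2)%N = k) p q
    (U : 'M[R]_(k2, p)) (W : 'M[R]_(k, q)) :
  (W^T <= (castmx (e, erefl) (block_mx 1%:M 0 0 U))^T)%MS =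
  ((rowsub (cast_ord e \o @rshift k1 k2) W)^T <= U^T)%MS.
Proof.
case: k / e in W *; rewrite castmx_id.
have -> : rowsub (cast_ord erefl \o @rshift k1 k2) W = dsubmx W.
  by apply/matrixP=> i j; rewrite !mxE /= cast_ord_id.
apply/col_subP/col_subP => [[X ->]|[X WX]].
  by exists (dsubmx X); rewrite -{1}[X]vsubmxK mul_block_col !mul0mx add0r col_mxKd.
exists (col_mx (usubmx W) X).
by rewrite mul_block_col !mul0mx mul1mx addr0 add0r -WX vsubmxK.
Qed.

(** * Recovering the configuration *)

Lemma mpinv_left m n (A : 'M[R]_(m, n)) : row_free A^T -> mpinv A *m A = 1%:M.
Proof.
move=> Afree; have /and4P[/eqP AXA _ _ _] := mpinvP A.
apply: trmx_inj; apply: (row_free_inj Afree).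
by rewrite /= -!trmx_mul mulmxA AXA mulmx1.
Qed.

(** The last column has norm 1, so [c != 0] and its orthogonality to [A] passes
to [w]. *)
Lemma orthonormal_split m t (A : 'M[R]_(m, t)) (w : 'cV[R]_m) c :
    (row_mx A (c *: w))^T *m row_mx A (c *: w) = 1%:M -> A^T *m w = 0.
Proof.
rewrite tr_row_mx mul_col_row scalar_mx_block => /eq_block_mx[_ Aw _ ww].
rewrite -scalemxAr in Aw; apply/eqP; have /eqP := Aw; rewrite scaler_eq0.
case/orP => // /eqP c0; move: ww; rewrite c0 scale0r mulmx0 => /matrixP/(_ 0 0)/eqP.
by rewrite !mxE eq_sym oner_eq0.
Qed.

(** Since [e] lies in the column space of [U], [U w = e], so the last column of
the orthogonal matrix [[Vb (c w)]] is the direction of [e] in the coordinates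
given by [U], and it contributes nothing to the centered matrix [J P]. *)
Lemma centered_coords k r t (P : 'M[R]_(k, r)) (U : 'M[R]_(k, t + 1))
    (Vb : 'M[R]_(t + 1, t)) c :
  let w := U^T *m ones k in
    ((homog P)^T <= U^T)%MS -> U^T *m U = 1%:M ->
    (row_mx Vb (c *: w))^T *m row_mx Vb (c *: w) = 1%:M ->
  Jmx k *m P = U *m Vb *m (Vb^T *m U^T *m P).
Proof.
move=> w; have wE : w = U^T *m ones k by [].
clearbody w => /col_subP[X PX] UU VV.
(* U U^T projects onto the column space of U, which contains that of homog P. *)
have UUP q (Y : 'M_(_, q)) : U *m U^T *m (homog P *m Y) = homog P *m Y.
  by rewrite PX -!mulmxA (mulmxA U^T) UU mul1mx.
have Ue : U *m w = ones k.
  have <- : homog P *m col_mx 0 1%:M = ones k.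
    by rewrite mul_row_col mulmx0 add0r mulmx1.
  rewrite -UUP wE mulmxA; congr (_ *m _).
  by rewrite mul_row_col mulmx0 add0r mulmx1.
have UJP : U *m U^T *m (Jmx k *m P) = Jmx k *m P.
  rewrite JmxE; have -> : P - ones k *m mean P = homog P *m col_mx 1%:M (- mean P).
    by rewrite mul_row_col mulmx1 mulmxN.
  exact: UUP.
have Vw := orthonormal_split VV.
have VbU : Vb^T *m U^T *m (Jmx k *m P) = Vb^T *m U^T *m P.
  by rewrite JmxE mulmxBr mulmxA -(mulmxA Vb^T _ (ones k)) -wE Vw mul0mx subr0.
have UUT : U *m U^T =
    U *m Vb *m (Vb^T *m U^T) + (c * c) *: (ones k *m (ones k)^T).
  have /mulmx1C := VV; rewrite tr_row_mx mul_row_col => VVT.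
  rewrite -{1}[U]mulmx1 -VVT mulmxDr mulmxDl !mulmxA [(c *: w)^T]linearZ /=.
  by rewrite -!scalemxAr -!scalemxAl scalerA -Ue trmx_mul !mulmxA.
rewrite -VbU -[LHS]UJP UUT mulmxDl -scalemxAl -(mulmxA (ones k)).
by rewrite (mulmxA (ones k)^T) ones_Jmx mul0mx mulmx0 scaler0 addr0 !mulmxA.
Qed.

(** With [Y] the coordinates of the centered points in the basis [U Vb], the
whole configuration and its part selected by [g] are governed by the same
matrix [Y Y^T]; independence of the part makes it recoverable from [B]. *)
Lemma completion k r b t (P : 'M[R]_(k, r)) (g : 'I_b -> 'I_k)
    (U : 'M[R]_(k, t + 1)) (Vb : 'M[R]_(t + 1, t)) c :
  let w := U^T *m ones k in
  let Pb := rowsub g P in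
  let M := Jmx b *m rowsub g U *m Vb in
  let B := Kdag (sqdist Pb) in
  let Z := mpinv M *m B *m (mpinv M)^T in
    row_free (homog Pb)^T -> (U^T == (homog P)^T)%MS -> U^T *m U = 1%:M ->
    (row_mx Vb (c *: w))^T *m row_mx Vb (c *: w) = 1%:M ->
  [/\ t = r, posdef Z, M *m Z *m M^T = B,
      forall Z' : 'M[R]_t, M *m Z' *m M^T = B -> Z' = Z
    & sqdist P = Kop ((U *m Vb) *m Z *m (U *m Vb)^T)].
Proof.
move=> w Pb M; have ME : M = Jmx b *m rowsub g U *m Vb by [].
clearbody M => B Z Pfree UP UU VV.
have tr : t = r.
  have : row_free U^T by apply/row_freeP; exists U.
  have := homog_free_rowsub Pfree.
  rewrite /row_free (eqmx_rank UP) => /eqP -> /eqP.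
  by rewrite !addn1 => -[].
have [/andP[_ PU]] := UP; have JP := centered_coords PU UU VV.
case: r / tr in P Pb B Z Pfree UP PU JP *.
set Y := Vb^T *m U^T *m P in JP.
(* Centering all the points first does not change the centered part. *)
have JPb : Jmx b *m Pb = M *m Y.
  have -> : M *m Y = Jmx b *m rowsub g (Jmx k *m P).
    by rewrite JP ME -!mulmxA mul_rowsub_mx.
  rewrite (JmxE P); have -> : rowsub g (P - ones k *m mean P) = Pb - ones b *m mean P.
    by apply/matrixP=> i j; rewrite !mxE !big_ord1 !mxE.
  by rewrite (mulmxBr (Jmx b)) mulmxA Jmx_ones mul0mx subr0.
(* If J P_beta v = 0, then <v, .> is constant on the selected points. *)
have MYfree : row_free (M *m Y)^T.
  apply/col_freeP => v; rewrite -JPb -mulmxA JmxE => Pv.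
  have : col_mx v (- mean (Pb *m v)) = 0.
    by move/col_freeP: Pfree; apply; rewrite mul_row_col mulmxN.
  by rewrite -[0]vsubmxK => /eq_col_mx[-> _]; rewrite linear0.
have Yunit : Y \in unitmx.
  rewrite -unitmx_tr -row_free_unit -row_leq_rank.
  by apply: leq_trans (mxrankM_maxl _ M^T); rewrite -trmx_mul row_leq_rank.
have Mfree : row_free M^T.
  rewrite -row_leq_rank; apply: leq_trans (mxrankM_maxr Y^T _).
  by rewrite -trmx_mul row_leq_rank.
have MM := mpinv_left Mfree.
have MMT : M^T *m (mpinv M)^T = 1%:M by rewrite -trmx_mul MM trmx1.
have BE : B = M *m (Y *m Y^T) *m M^T.
  by rewrite /B Kdag_sqdist JPb trmx_mul !mulmxA.
have ZE Z' : M *m Z' *m M^T = B -> Z' = Z.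
  by rewrite /Z => <-; rewrite -!mulmxA MMT mulmx1 !mulmxA MM mul1mx.
rewrite -(ZE (Y *m Y^T)) //; split=> //.
- by apply: posdef_gram; rewrite row_free_unit.
- by move=> Z' /ZE ->; rewrite -(ZE (Y *m Y^T)).
- rewrite -(sqdist_translate P (mean P)) -JmxE JP sqdistE.
  by rewrite [(_ *m Y)^T]trmx_mul !mulmxA.
Qed.

End Points.

(** * Enumeration of index sets *)

(** Sets of ordinals are enumerated in increasing order, since [enum 'I_n] is
[iota 0 n]. *)
Lemma enum_val_interval n a b (A : {set 'I_n}) (i : 'I_#|A|) :
    (b <= n)%N -> (forall j : 'I_n, (j \in A) = (a <= j < b)%N) ->
  enum_val i = (a + i)%N :> nat.
Proof.
move=> bn AE; have i0 := enum_val i.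
have AI : [seq val j | j <- enum A] = iota a (b - a).
  rewrite /enum_mem -enumT.
  rewrite (eq_filter (a2 := preim val (fun j => a <= j < b)%N)); last exact: AE.
  rewrite -filter_map val_enum_ord.
  apply: (irr_sorted_eq ltn_trans ltnn).
  - exact/(sorted_filter ltn_trans)/iota_ltn_sorted.
  - exact: iota_ltn_sorted.
  - by move=> j; rewrite mem_filter !mem_iota; lia.
rewrite (enum_val_nth i0) -(nth_map _ 0%N) -?cardE // AI nth_iota //.
by rewrite -(size_iota a (b - a)) -AI size_map -cardE.
Qed.

(** Position in [A] of the [i]-th element of [B]; it is the row selection made by
[rows_of]. *)
Definition sub_index n (A B : {set 'I_n}) (sBA : B \subset A) (i : 'I_#|B|) : 'I_#|A| :=
  enum_rank_in (subsetP sBA _ (enum_valP i)) (enum_val i).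

Lemma sub_indexK n (A B : {set 'I_n}) (sBA : B \subset A) i :
  enum_val (sub_index sBA i) = enum_val i.
Proof. exact: enum_rankK_in (subsetP sBA _ (enum_valP i)). Qed.

Section Inclusions.
Variables (n c1 c2 c3 : nat) (hn : (c1 + c2 + c3 <= n)%N).
Let a1 := alpha1 n c1 c2.
Let a2 := alpha2 n c1 c2 c3.

(** The row indices of the upper left block of [blocks1] and, in [incl2], of the
lower right block of [blocks2]; [incl1K] and [incl2K] say that the casts in
these blocks respect the enumerations of the index sets. *)
Definition incl1 : 'I_#|a1| -> 'I_#|a1 :|: a2| :=
  cast_ord (card_blocks1 hn) \o lshift c3.

Definition incl2 : 'I_#|a2| -> 'I_#|a1 :|: a2| :=
  cast_ord (card_blocks2 hn) \o @rshift c1 #|a2|.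

Let in_alphaU (j : 'I_n) : (j \in a1 :|: a2) = (0 <= j < c1 + c2 + c3)%N.
Proof. by rewrite !inE; lia. Qed.

Lemma incl1K i : enum_val (incl1 i) = enum_val i.
Proof.
apply: val_inj => /=; rewrite (enum_val_interval (incl1 i) hn in_alphaU).
rewrite (@enum_val_interval n 0 (c1 + c2) a1) ?(leq_trans (leq_addr _ _) hn) //.
by move=> j; rewrite inE.
Qed.

Lemma incl2K i : enum_val (incl2 i) = enum_val i.
Proof.
apply: val_inj => /=; rewrite (enum_val_interval (incl2 i) hn in_alphaU).
by rewrite (@enum_val_interval n c1 (c1 + c2 + c3) a2) // => j; rewrite inE.
Qed.

Lemma incl_cover i : (exists j, i = incl1 j) \/ (exists j, i = incl2 j).
Proof.
have := enum_valP i; rewrite inE => /orP[ia|ia]; [left | right];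
  exists (enum_rank_in ia (enum_val i)); apply: enum_val_inj.
  by rewrite incl1K enum_rankK_in.
by rewrite incl2K enum_rankK_in.
Qed.

End Inclusions.

(** * Completion from two overlapping principal submatrices *)

Theorem theorem2p10 (R : realType) (n r : nat) (D : 'M[R]_n)
  (hEDM : EDM D) (hr : embdim D r)
  (c1 c2 c3 : nat) (hn : (c1 + c2 + c3 <= n)%N) :
  let a1 := alpha1 n c1 c2 in
  let a2 := alpha2 n c1 c2 c3 in
  let k1 := #|a1| in
  let k2 := #|a2| in
  let k := #|a1 :|: a2| in
  forall (hk1 : (1 <= k1)%N) (hk2 : (1 <= k2)%N)
    (t1 t2 : nat)
    (ht1 : embdim (psub D a1) t1) (ht2 : embdim (psub D a2) t2)
    (Ubar1 : 'M[R]_(k1, t1)) (S1 : 'M[R]_t1)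
    (hB1 : Kdag (psub D a1) = Ubar1 *m S1 *m Ubar1^T)
    (hUbar1 : Ubar1^T *m Ubar1 = 1%:M) (hS1 : posdef S1)
    (Ubar2 : 'M[R]_(k2, t2)) (S2 : 'M[R]_t2)
    (hB2 : Kdag (psub D a2) = Ubar2 *m S2 *m Ubar2^T)
    (hUbar2 : Ubar2^T *m Ubar2 = 1%:M) (hS2 : posdef S2),
  let U1 : 'M[R]_(k1, t1 + 1) :=
    row_mx Ubar1 ((Num.sqrt k1%:R)^-1 *: ones k1) in
  let U2 : 'M[R]_(k2, t2 + 1) :=
    row_mx Ubar2 ((Num.sqrt k2%:R)^-1 *: ones k2) in
  forall (t : nat) (Ubar : 'M[R]_(k, t + 1))
    (hrange : (Ubar^T == (blocks1 hn U1)^T :&: (blocks2 hn U2)^T)%MS)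
    (hUbar : Ubar^T *m Ubar = 1%:M)
    (beta : {set 'I_n}) (hbeta0 : beta != set0)
    (hbeta : beta \subset a1 :&: a2),
  let Dbar := psub D beta in
  let B := Kdag Dbar in
  let Ubeta := rows_of (sub_setIU hbeta) Ubar in
  let w : 'cV[R]_(t + 1) := Ubar^T *m ones k in
  forall (Vbar : 'M[R]_(t + 1, t)),
  let V : 'M[R]_(t + 1) := row_mx Vbar ((enorm w)^-1 *: w) in
  forall (hV : V^T *m V = 1%:M),
  let M := Jmx #|beta| *m Ubeta *m Vbar in
  let Z := mpinv M *m B *m (mpinv M)^T in
  embdim Dbar r ->
  [/\ t = r,
      posdef Z,
      M *m Z *m M^T = B,
      (forall Z' : 'M[R]_t, M *m Z' *m M^T = B -> Z' = Z)
    & psub D (a1 :|: a2) = Kop ((Ubar *m Vbar) *m Z *m (Ubar *m Vbar)^T)].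
Proof.
move=> a1 a2 k1 k2 k hk1 hk2 t1 t2 _ _ Ubar1 S1 hB1 hUbar1 hS1.
move=> Ubar2 S2 hB2 hUbar2 hS2 U1 U2 t Ubar hrange hUbar beta beta0 hbeta.
have [/EDM_inP[P DP] _] := hr.
have psubE A : psub D A = sqdist (rowsub (@enum_val _ (mem A)) P).
  by rewrite sqdist_rowsub -DP.
rewrite /rows_of -/(sub_index (sub_setIU hbeta)) !psubE.
rewrite !psubE in hB1 hB2.
move=> Vbar hV hDbar.
set PU := rowsub (@enum_val _ (mem (a1 :|: a2))) P.
pose g := sub_index (sub_setIU hbeta).
have sb1 := subset_trans hbeta (subsetIl _ _).
have sb2 := subset_trans hbeta (subsetIr _ _).
have P1E : rowsub (@enum_val _ (mem a1)) P = rowsub (incl1 hn) PU.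
  by rewrite -rowsub_comp; apply: eq_rowsub => i; rewrite /= incl1K.
have P2E : rowsub (@enum_val _ (mem a2)) P = rowsub (incl2 hn) PU.
  by rewrite -rowsub_comp; apply: eq_rowsub => i; rewrite /= incl2K.
have PbE : rowsub (@enum_val _ (mem beta)) P = rowsub g PU.
  by rewrite -rowsub_comp; apply: eq_rowsub => i; rewrite /= sub_indexK.
have g1E : incl1 hn \o sub_index sb1 =1 g.
  by move=> i; apply: enum_val_inj; rewrite /= incl1K !sub_indexK.
have g2E : incl2 hn \o sub_index sb2 =1 g.
  by move=> i; apply: enum_val_inj; rewrite /= incl2K !sub_indexK.
rewrite P1E in hB1; rewrite P2E in hB2.
have g12 : incl1 hn \o sub_index sb1 =1 incl2 hn \o sub_index sb2.
  by move=> i; rewrite g1E g2E.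
have sqrtV0 (m : nat) : (0 < m)%N -> (Num.sqrt (m%:R : R))^-1 != 0.
  by move=> m0; rewrite invr_eq0 sqrtr_eq0 -ltNge ltr0n.
have beta_free : row_free (homog (rowsub g PU))^T.
  by rewrite -PbE; apply: homog_free; rewrite ?card_gt0.
(* The intersection in the hypothesis on Ubar is the column space of homog PU. *)
have range_cap q (W : 'M_(k, q)) :
    (W^T <= (blocks1 hn U1)^T :&: (blocks2 hn U2)^T)%MS = (W^T <= (homog PU)^T)%MS.
  rewrite sub_capmx block_range1 block_range2.
  rewrite (homog_colspace hB1 hUbar1 hS1 (sqrtV0 _ hk1)).
  rewrite (homog_colspace hB2 hUbar2 hS2 (sqrtV0 _ hk2)).
  by rewrite (homog_glue W g12 (incl_cover hn)) // (eq_rowsub _ g1E).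
have UP : (Ubar^T == (homog PU)^T)%MS.
  apply/andP; split; first by rewrite -range_cap; case/andP: hrange.
  by rewrite (eqmxP hrange) range_cap.
rewrite PbE; exact: completion beta_free UP hUbar hV.
Qed.
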